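(* Let $h(x):=x^4+b_2x^2+b_1x+b_0$ with $b_0,b_1,b_2\in\mathbb{R}$, and let $\Delta:=-16\,[8\,b_2^3+27\,b_1^2]$, i.e. $\Delta$ is the discriminant of $h'(x)=4x^3+2b_2x+b_1$. Then $h$ is quasi-convex if and only if $\Delta\le0$. In this situation, $b_2\ge-\tfrac32\,b_1^{2/3}$.
   Context: A function $h:\mathbb{R}\to\mathbb{R}$ is quasi-convex if for every $\alpha\in\mathbb{R}$ the set $\{x\in\mathbb{R}: h(x)\le\alpha\}$ is convex. Here $b_1^{2/3}:=(\sqrt[3]{b_1})^2$ with the real cube root. *)

(* Defs.v *)
From HB Require Import structures.
From mathcomp Require Import all_boot all_order all_algebra.
From mathcomp Require Import all_classical all_reals exp convex.

Set Implicit Arguments.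
Unset Strict Implicit.
Unset Printing Implicit Defensive.

Import Order.TTheory GRing.Theory Num.Theory.

Local Open Scope classical_set_scope.
Local Open Scope ring_scope.

Definition quasi_convex (R : realType) (h : R -> R) : Prop :=
  forall a : R, @convex_set R R^o [set x : R | h x <= a].

(* [powR] is unsuitable at negative bases, hence the sign. *)
Definition cbrt (R : realType) (x : R) : R := Num.sg x * `|x| `^ 3^-1.

Lemma cbrtK (R : realType) (x : R) : cbrt x ^+ 3 = x.
Proof.
rewrite /cbrt exprMn -[in X in _ * X]powR_mulrn ?powR_ge0// -powRrM mulVf ?pnatr_eq0//.
rewrite powRr1// exprS sqr_sg.
have [->|x0] := eqVneq x 0; first by rewrite sgr0 !mul0r.
by rewrite mulr1 -numEsg.
Qed.

(* disc p = (-1)^(n(n-1)/2) / lc(p) * Res(p, p'), n = deg p >= 1.  The Sylvester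
   matrix underlying [resultant] lists coefficients by increasing degree, which
   changes the textbook resultant of p and q by (-1)^(deg p * deg q); this sign
   is 1 for q = p' in characteristic 0. *)
Definition discriminant (F : fieldType) (p : {poly F}) : F :=
  (-1) ^+ 'C((size p).-1, 2) / lead_coef p * resultant p p^`().

(* Main.v *)
Require Import Defs.
From mathcomp Require Import all_boot all_order all_algebra.
From mathcomp Require Import all_classical all_reals exp convex.
From mathcomp Require Import unstable interval_inference polyrcf ring lra.

(** The cubic [h'] has either a single sign change, and then [h] decreases up to
    that point and increases after it, or three simple real roots, and then [h]
    has a strict local maximum at the middle one. The first shape is
    quasi-convex and the second is not, so the question is how the sign of the
    discriminant tells them apart.

    Let [r] be a real root of [h']. Eliminating [b1],
    [h' = (x - r) * ((2 x + r)^2 + (2 b2 + 3 r^2))] and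
    [8 b2^3 + 27 b1^2 = 4 (2 b2 + 3 r^2) (b2 + 6 r^2)^2]
    ([cubic_disc_root]). If this quantity is nonnegative, some root satisfies
    [0 <= 2 b2 + 3 r^2], so that [h'] has the sign of [x - r]
    ([cubic_single_sign_change]). If it is negative, the cubic takes opposite
    signs at its two extremal points [+- sqrt (- b2 / 6)], and so vanishes at
    some [m] between them, where [h''(m) < 0] ([cubic_middle_root]); since
    [h (m + u) - h m = u^2 (u^2 + 4 m u + 6 m^2 + b2)], both neighbours
    [m - u] and [m + u] lie below [m] for small [u], which quasi-convexity
    forbids.

    The lower bound on [b2] is the inequality
    [(- 3 c^2)^3 <= (2 b2)^3], with [b1 = c^3], after taking cube roots.
    The value of the discriminant itself is the Sylvester determinant of order
    five, expanded by Laplace's rule. *)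

Set Implicit Arguments.
Unset Strict Implicit.
Unset Printing Implicit Defensive.

Import Order.TTheory GRing.Theory Num.Theory.

Local Open Scope ring_scope.
Local Open Scope convex_scope.

(** * The discriminant of a depressed cubic *)

(** The same function as [bump], without the detour through [eqType] that blocks
    its evaluation. *)
Definition skip (j k : nat) : nat := if (j - k)%N is 0%N then k.+1 else k.

Lemma skipE j k : skip j k = bump j k.
Proof. by rewrite /skip /bump /leq; case: (j - k)%N. Qed.

(** Laplace expansion along the first row. Indexing entries by [nat] makes the
    minors closed under the recursion and lets the expansion compute. *)
Fixpoint laplace (R : pzRingType) (n : nat) (f : nat -> nat -> R) : R :=
  if n is m.+1 then
    \sum_(0 <= j < n)
      f 0%N j * ((-1) ^+ j * laplace m (fun i k => f i.+1 (skip j k)))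
  else 1.

Lemma det_laplace (R : comPzRingType) (n : nat) (f : nat -> nat -> R) :
  \det (\matrix_(i < n, j < n) f i j) = laplace n f.
Proof.
elim: n f => [|n IHn] f /=; first by rewrite det_mx00.
rewrite (expand_det_row _ ord0) big_mkord; apply: eq_bigr => j _.
rewrite mxE /cofactor -IHn; congr (_ * (_ * \det _)).
by apply/matrixP => i k; rewrite !mxE skipE.
Qed.

Lemma resultantE (R : comNzRingType) (p q : {poly R}) (m n : nat) :
    size p = n.+1 -> size q = m.+1 ->
  resultant p q = \det (\matrix_(i < m + n, j < m + n)
    (if (i < m)%N then p`_(j - i) *+ (i <= j)%N
     else q`_(j - (i - m)) *+ (i - m <= j)%N)).
Proof.
move=> sp sq; have [-> ->] : n = (size p).-1 /\ m = (size q).-1.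
  by rewrite sp sq.
congr (\det _); apply/matrixP => i j.
rewrite Sylvester_mxE mxE; case: splitP => k -> //.
by rewrite addKn.
Qed.

(** The hypothesis on [3] keeps the derivative of degree two, so that the
    Sylvester matrix has order five. *)
Lemma discriminant_depressed_cubic (F : fieldType) (a c d : F) :
    a != 0 -> 3 != 0 :> F ->
  discriminant (a *: 'X^3 + c *: 'X + d%:P)
    = - 4 * a * c ^+ 3 - 27 * a ^+ 2 * d ^+ 2.
Proof.
move=> a0 n3; set p := (X in discriminant X).
have pE : p = Poly [:: d; c; 0; a].
  apply/polyP => i; rewrite coef_Poly !coefE.
  by case: i => [|[|[|[|i]]]] /=; rewrite ?(mulr0, mulr1, addr0, add0r, nth_nil).
have dE : p^`() = Poly [:: c; 0; 3 * a].
  apply/polyP => i; rewrite coef_deriv pE !coef_Poly.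
  by case: i => [|[|[|i]]] /=;
    rewrite ?mulr1n ?mul0rn ?mulr_natl ?nth_nil ?mul0rn.
have sp : size p = 4%N by rewrite pE (@PolyK _ 0).
have sq : size p^`() = 3%N by rewrite dE (@PolyK _ 0)//= mulf_neq0.
(* The Sylvester matrix of [p] and its derivative: two shifts of the former,
   three of the latter, by increasing degree. *)
pose S := [:: [:: d; c; 0; a; 0];
              [:: 0; d; c; 0; a];
              [:: c; 0; 3 * a; 0; 0];
              [:: 0; c; 0; 3 * a; 0];
              [:: 0; 0; c; 0; 3 * a]].
have -> : discriminant p
    = (-1) ^+ 3 / a * laplace 5 (fun i j => nth 0 (nth [::] S i) j).
  rewrite /discriminant (resultantE sp sq) /lead_coef sp {1}pE coef_Poly.
  rewrite -det_laplace; congr (_ * \det _).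
  apply/matrixP => i j; rewrite !mxE dE pE !coef_Poly.
  by case: i j => [[|[|[|[|[|//]]]]] ?] [[|[|[|[|[|//]]]]] ?].
(* Only indices are evaluated: the ring operations stay folded for [field]. *)
rewrite /laplace unlock.
lazy beta iota zeta delta [S laplace reducebig foldr index_iota iota subn subn_rec
  Nat.sub skip nth applybig comp].
by field.
Qed.

(** * Quasi-convexity on the line *)

(** The single instance of convexity used to refute quasi-convexity: a point
    cannot lie strictly above two points symmetric about it. *)
Lemma quasi_convex_midpoint (R : realType) (f : R -> R) (m u : R) :
  quasi_convex f -> f m <= Num.max (f (m - u)) (f (m + u)).
Proof.
move=> qf; set M := Num.max _ _.
have k0 : 0 <= (2^-1 : R) by lra.
have k1 : (2^-1 : R) <= 1 by lra.
have inl : m - u \in [set x | f x <= M]%classic.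
  by apply/mem_set; rewrite /= le_max lexx.
have inr : m + u \in [set x | f x <= M]%classic.
  by apply/mem_set; rewrite /= le_max lexx orbT.
have mE : (m - u : R^o) <| Itv01 k0 k1 |> (m + u : R^o) = m.
  by rewrite convRE /= /onem; field.
by rewrite -{1}mE; apply/set_mem: (qf M _ _ (Itv01 k0 k1) inl inr).
Qed.

Lemma quasi_convex_unimodal (R : realType) (f : R -> R) (r : R) :
    (forall x y, x <= y -> y <= r -> f y <= f x) ->
    (forall x y, r <= x -> x <= y -> f x <= f y) ->
  quasi_convex f.
Proof.
move=> fdec finc a x y k; wlog xy : x y k / x <= y => [hw|].
  have [/hw|/ltW yx xA yA] := leP x y; first exact.
  by rewrite convC; exact: hw.
rewrite !inE /= => fx fy.
have /andP[xz zy] : x <= x <| k |> y <= y.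
  by have := convR_itv k xy; rewrite in_itv.
set z := (_ <| _ |> _) in xz zy *.
by have [zr|/ltW rz] := leP z r;
  [apply: le_trans (fdec x z _ _) fx | apply: le_trans (finc z y _ _) fy].
Qed.

Lemma deriv_ge0_le (R : rcfType) (p : {poly R}) (a b : R) : a <= b ->
  (forall x, a < x < b -> 0 <= p^`().[x]) -> p.[a] <= p.[b].
Proof.
rewrite le_eqVlt => /predU1P[-> //|ab] dp.
have [c /[!in_itv]/= cab E] := poly_mvt p ab.
by rewrite -subr_ge0 E mulr_ge0 ?dp// subr_ge0 ltW.
Qed.

Lemma quasi_convex_deriv (R : realType) (p : {poly R}) (r : R) :
    (forall x, x < r -> p^`().[x] <= 0) -> (forall x, r < x -> 0 <= p^`().[x]) ->
  quasi_convex (horner p).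
Proof.
move=> dl dr; apply: (@quasi_convex_unimodal _ _ r) => x y.
  move=> xy yr; rewrite -lerN2 -!hornerN; apply: deriv_ge0_le => // t /andP[_ ty].
  by rewrite derivN hornerN oppr_ge0 dl// (lt_le_trans ty).
move=> rx xy; apply: deriv_ge0_le => // t /andP[xt _].
by rewrite dr// (le_lt_trans rx).
Qed.

(** * Depressed quartics *)

Lemma horner_depressed_cubic (R : comNzRingType) (a c d x : R) :
  (a *: 'X^3 + c *: 'X + d%:P).[x] = a * x ^+ 3 + c * x + d.
Proof. by rewrite !(hornerD, hornerZ, hornerXn, hornerX, hornerC). Qed.

Lemma horner_depressed_quartic (R : comNzRingType) (b0 b1 b2 x : R) :
  ('X^4 + b2 *: 'X^2 + b1 *: 'X + b0%:P).[x]
    = x ^+ 4 + b2 * x ^+ 2 + b1 * x + b0.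
Proof. by rewrite !(hornerD, hornerZ, hornerXn, hornerX, hornerC). Qed.

Lemma deriv_depressed_quartic (R : nzRingType) (b0 b1 b2 : R) :
  ('X^4 + b2 *: 'X^2 + b1 *: 'X + b0%:P)^`()
    = 4 *: 'X^3 + (2 * b2) *: 'X + b1%:P.
Proof.
rewrite !derivE addr0 -!alg_polyC; congr (_ + _ + _).
  by rewrite scaler_nat.
by rewrite expr1 -scalerMnr scalerMnl mulr_natl.
Qed.

(** At a critical point [r] of the quartic the discriminant factors; the two
    factors are, up to constants, those of the discriminant of
    [(x - r) * (4 x^2 + 4 r x + 4 r^2 + 2 b2)]. *)
Lemma cubic_disc_root (R : comNzRingType) (b1 b2 r : R) :
    4 * r ^+ 3 + 2 * b2 * r + b1 = 0 ->
  8 * b2 ^+ 3 + 27 * b1 ^+ 2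
    = 4 * (2 * b2 + 3 * r ^+ 2) * (b2 + 6 * r ^+ 2) ^+ 2.
Proof.
move=> /eqP; rewrite addrC addr_eq0 => /eqP ->; ring.
Qed.

Lemma depressed_cubic_root (R : rcfType) (b1 b2 : R) :
  exists r, 4 * r ^+ 3 + 2 * b2 * r + b1 = 0.
Proof.
pose p : {poly R} := 4 *: 'X^3 + (2 * b2) *: 'X + b1%:P.
(* The cubic term dominates at [+- M], since [1], [`|b1|],
   [`|b2|] are at most [M]. *)
pose M := 1 + `|b1| + `|b2|.
have M1 : 1 <= M by rewrite /M -addrA lerDl addr_ge0.
have NM : - M <= M by lra.
have /andP[b1l b1r] : - M <= b1 <= M.
  by rewrite -ler_norml /M; have := normr_ge0 b2; lra.
have /andP[b2l b2r] : - M <= b2 <= M.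
  by rewrite -ler_norml /M; have := normr_ge0 b1; lra.
have Ml : 0 <= M * (M + b2) by rewrite mulr_ge0; lra.
have M2 : 0 <= M * (M - 1) by rewrite mulr_ge0; lra.
have M3 : 0 <= M ^+ 2 * (M - 1) by rewrite mulr_ge0 ?sqr_ge0; lra.
have [|r _ /rootP] := @Num.poly_ivt _ p _ _ NM.
  rewrite /p !horner_depressed_cubic; apply/andP; split; lra.
by rewrite horner_depressed_cubic => rE; exists r.
Qed.

(** At a root [r] with [2 b2 + 3 r^2 < 0], the factorization of [cubic_disc_root]
    can only be nonnegative if [b2 + 6 r^2 = 0]. Then [r] is a double root, the
    remaining root is [- 2 r] since the roots sum to zero, and that one fits. *)
Lemma cubic_single_sign_change (R : rcfType) (b1 b2 : R) :
    0 <= 8 * b2 ^+ 3 + 27 * b1 ^+ 2 ->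
  exists2 r, 4 * r ^+ 3 + 2 * b2 * r + b1 = 0 & 0 <= 2 * b2 + 3 * r ^+ 2.
Proof.
have [r rE] := depressed_cubic_root b1 b2; rewrite (cubic_disc_root rE) => D.
have [|neg] := leP 0 (2 * b2 + 3 * r ^+ 2); first by exists r.
have /eqP b2E : b2 + 6 * r ^+ 2 == 0.
  rewrite -sqrf_eq0 eq_le sqr_ge0 andbT.
  rewrite -(@nmulr_rge0 _ (4 * (2 * b2 + 3 * r ^+ 2)))//.
  by lra.
exists (- 2 * r); last by lra.
have b2E' : b2 = - 6 * r ^+ 2 by lra.
by move: rE; rewrite b2E'; lra.
Qed.

Lemma quasi_convex_depressed_quartic (R : realType) (b0 b1 b2 : R) :
    0 <= 8 * b2 ^+ 3 + 27 * b1 ^+ 2 ->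
  quasi_convex (horner ('X^4 + b2 *: 'X^2 + b1 *: 'X + b0%:P)).
Proof.
move=> /cubic_single_sign_change[r rE k0].
have dE x : ('X^4 + b2 *: 'X^2 + b1 *: 'X + b0%:P)^`().[x]
    = (x - r) * ((2 * x + r) ^+ 2 + (2 * b2 + 3 * r ^+ 2)).
  rewrite deriv_depressed_quartic horner_depressed_cubic.
  have -> : b1 = - (4 * r ^+ 3 + 2 * b2 * r) by lra.
  by ring.
have q0 x : 0 <= (2 * x + r) ^+ 2 + (2 * b2 + 3 * r ^+ 2).
  by rewrite addr_ge0 ?sqr_ge0.
apply: (@quasi_convex_deriv _ _ r) => x xr; rewrite dE.
  by rewrite mulr_le0_ge0// subr_le0 ltW.
by rewrite mulr_ge0// subr_ge0 ltW.
Qed.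

Lemma cubic_middle_root (R : rcfType) (b1 b2 : R) :
    8 * b2 ^+ 3 + 27 * b1 ^+ 2 < 0 ->
  exists2 m, 4 * m ^+ 3 + 2 * b2 * m + b1 = 0 & 6 * m ^+ 2 + b2 < 0.
Proof.
move=> D.
have b2neg : b2 < 0.
  rewrite ltNge; apply/negP => /(exprn_ge0 3) b2ge.
  by have b1ge := sqr_ge0 b1; lra.
(* The positive critical point of the cubic, where it has its local minimum. *)
pose t := Num.sqrt (- b2 / 6).
have t0 : 0 < t by rewrite sqrtr_gt0; lra.
have b2E : b2 = - 6 * t ^+ 2 by rewrite sqr_sqrtr; lra.
have b1t : `|b1| < 8 * t ^+ 3.
  rewrite -(@ltr_pXn2r _ 2) ?nnegrE ?normr_ge0// ?real_normK ?num_real//.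
    by rewrite b2E in D; lra.
  by rewrite mulr_ge0 ?exprn_ge0 ?(ltW t0)//.
move: b1t; rewrite ltr_norml => /andP[b1l b1r].
(* [p] is negated because [poly_ivt] wants a change from negative to positive:
   the cubic is positive at [- t] and negative at [t]. *)
pose p : {poly R} := - (4 *: 'X^3 + (2 * b2) *: 'X + b1%:P).
have NM : - t <= t by lra.
have pE x : p.[x] = - (4 * x ^+ 3 + 2 * b2 * x + b1).
  by rewrite hornerN horner_depressed_cubic.
have [|m /andP[m1 m2] /rootP/eqP] := @Num.poly_ivt _ p _ _ NM.
  by rewrite !pE b2E; apply/andP; split; lra.
rewrite pE oppr_eq0 => /eqP mE; exists m => //.
have mt : m != t by apply: contraTneq isT => E; move: mE; rewrite E b2E; lra.
have mNt : m != - t by apply: contraTneq isT => E; move: mE; rewrite E b2E; lra.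
have l1 : - t < m by rewrite lt_neqAle eq_sym mNt.
have l2 : m < t by rewrite lt_neqAle mt.
by rewrite b2E; nra.
Qed.

Lemma disc_of_quasi_convex_depressed_quartic (R : realType) (b0 b1 b2 : R) :
    quasi_convex (horner ('X^4 + b2 *: 'X^2 + b1 *: 'X + b0%:P)) ->
  0 <= 8 * b2 ^+ 3 + 27 * b1 ^+ 2.
Proof.
move=> qh; rewrite leNgt; apply/negP => /cubic_middle_root[m mE m0].
set h : {poly R} := (_ + b0%:P) in qh.
have hE v : h.[m + v] = h.[m] + v ^+ 2 * (v ^+ 2 + 4 * m * v + (6 * m ^+ 2 + b2)).
  rewrite /h !horner_depressed_quartic.
  have -> : b1 = - (4 * m ^+ 3 + 2 * b2 * m) by lra.
  by ring.
set k := 6 * m ^+ 2 + b2 in m0 hE.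
(* With this [u], [4 |m| u + k = - u + k u], so for [v = +- u] the last factor of
   [hE v] is at most [u (u - 1 + k)], negative because [u < 1] and [k < 0]. *)
pose u := - k / (1 + 4 * `|m| - k).
have d0 : 0 < 1 + 4 * `|m| - k by have := normr_ge0 m; lra.
have u0 : 0 < u by rewrite divr_gt0 // oppr_gt0.
have uE : u * (1 + 4 * `|m| - k) = - k by rewrite divfK // gt_eqF.
have u1 : u < 1 by rewrite ltr_pdivrMr//; have := normr_ge0 m; lra.
have lower v : `|v| = u -> h.[m + v] < h.[m].
  move=> vu; have v2 : v ^+ 2 = u ^+ 2 by rewrite -vu real_normK ?num_real.
  rewrite hE gtrDl pmulr_rlt0 v2 ?exprn_gt0//.
  have mv : m * v <= `|m| * u by rewrite -vu -normrM ler_norm.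
  have : u * (u - 1 + k) < 0 by rewrite pmulr_rlt0//; lra.
  by lra.
have := quasi_convex_midpoint m u qh.
rewrite le_max !leNgt lower ?lower//; first by rewrite gtr0_norm.
by rewrite normrN gtr0_norm.
Qed.

(** The hypothesis says [(- 3 c^2)^3 <= (2 b)^3], and cubing is increasing. *)
Lemma cuberoot_bound (R : realFieldType) (b c : R) :
  0 <= 8 * b ^+ 3 + 27 * (c ^+ 3) ^+ 2 -> - (3 / 2) * c ^+ 2 <= b.
Proof.
move=> D; rewrite leNgt; apply/negP => lt_b; have c2 := sqr_ge0 c.
have : (3 * c ^+ 2) ^+ 3 < (- 2 * b) ^+ 3 by rewrite ltr_pXn2r ?nnegrE//; lra.
by lra.
Qed.

Theorem lemma7 (R : realType) (b0 b1 b2 : R) :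
  let h : {poly R} := 'X^4 + b2 *: 'X^2 + b1 *: 'X + b0%:P in
  let Delta : R := - 16 * (8 * b2 ^+ 3 + 27 * b1 ^+ 2) in
  [/\ h^`() = 4 *: 'X^3 + (2 * b2) *: 'X + b1%:P,
      Delta = discriminant h^`(),
      quasi_convex (fun x : R => h.[x]) <-> Delta <= 0 &
      quasi_convex (fun x : R => h.[x]) -> - (3 / 2) * cbrt b1 ^+ 2 <= b2].
Proof.
move=> h Delta.
have dE : h^`() = 4 *: 'X^3 + (2 * b2) *: 'X + b1%:P.
  exact: deriv_depressed_quartic.
have D0 : (Delta <= 0) = (0 <= 8 * b2 ^+ 3 + 27 * b1 ^+ 2).
  by apply/idP/idP; rewrite /Delta; lra.
split=> //.
- rewrite dE discriminant_depressed_cubic ?pnatr_eq0// /Delta; ring.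
- rewrite D0; split; first exact: disc_of_quasi_convex_depressed_quartic.
  exact: quasi_convex_depressed_quartic.
- move=> /disc_of_quasi_convex_depressed_quartic.
  by rewrite -{1}(cbrtK b1); exact: cuberoot_bound.
Qed.
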